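(* Let $p$ be a prime and let $T$ be a plane bipartite tree with $N=pr$ edges, where $\gcd(p,r)=1$. Fix a white vertex $v_1$ and a black vertex $u_1$ of $T$, and consider the monic Shabat polynomial for $T$ in which $v_1$ is at the origin and $u_1$ is at the point $1$. Let $K$ be a number field containing the coordinates of all white and black vertices for this polynomial and its value at $1$, and let $\rho$ be a prime divisor of $K$ dividing $p$. Then there exists a monic Shabat polynomial of $T$ (a normalized model) such that some white vertex is at the origin, some black vertex is at the point $1$, and the coordinates of all white and black vertices lie in $K$ and are $\rho$-integral.
   Context: A plane bipartite tree is a tree embedded in the plane with vertices properly coloured white and black. A Shabat polynomial for $T$ (with $N$ edges) is here a polynomial $b\in\mathbb{C}[z]$ of degree $N$ whose finite critical values all lie in $\{0,c\}$ for some $c\neq 0$, such that $b^{-1}([0,c])$, where $[0,c]$ is the segment joining $0$ and $c$, with the points of $b^{-1}(0)$ as white vertices and the points of $b^{-1}(c)$ as black vertices, is isomorphic to $T$ as a plane bipartite tree (i.e. via an orientation-preserving homeomorphism of the plane). The coordinate of a vertex is its position as a complex number. For a prime divisor (finite place) $\rho$ of a number field $K$ with valuation $v_\rho$, an element $x\in K$ is $\rho$-integral if $v_\rho(x)\ge 0$. *)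

(* Defs.v *)
From HB Require Import structures.
From mathcomp Require Import all_boot all_order all_algebra all_field.
From mathcomp Require Import complex.
From mathcomp Require Import all_classical all_reals all_analysis.
Export numFieldNormedType.Exports.

Set Implicit Arguments.
Unset Strict Implicit.
Unset Printing Implicit Defensive.

Import Order.TTheory GRing.Theory Num.Theory.
Local Open Scope classical_set_scope.
Local Open Scope ring_scope.

(* The usual topology on the complex numbers, i.e. the one of the modulus. *)
HB.instance Definition _ (R : realType) := NormedModule.copy R[i] R[i]^o.

Section OrientationPreserving.
Variable R : realType.

Definition expi (t : R) : R[i] := (cos t +i* sin t)%C.

Definition plane_homeomorphism (h : R[i] -> R[i]) : Prop :=
  continuous h /\
  exists g : R[i] -> R[i], [/\ continuous g, cancel h g & cancel g h].

(* Local degree 1: the image of every positively oriented circle about z winds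
   once counterclockwise around h z, the winding number being read off from a
   continuous determination theta of the argument of h - h z on the circle. *)
Definition orientation_preserving (h : R[i] -> R[i]) : Prop :=
  forall (z : R[i]) (r : R), 0 < r ->
  exists theta : R -> R,
    [/\ continuous theta,
        forall t, h (z + (r%:C)%C * expi t) - h z =
                  `|h (z + (r%:C)%C * expi t) - h z| * expi (theta t)
      & theta (2 * pi) = theta 0 + 2 * pi].

End OrientationPreserving.

Definition is_tree (V : finType) (e : rel V) : Prop :=
  [/\ symmetric e /\ irreflexive e,
      (0 < #|V|)%N,
      forall x y, connect e x y
    & forall c : seq V, ucycle e c -> (size c <= 2)%N].

(* Every edge joins a white vertex w to a black vertex u; it is drawn in the
   plane as the simple arc (arc w u t), 0 <= t <= 1, from w to u.  The values
   of (arc w u) when (w, u) is not an edge directed from white to black, or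
   outside `[0, 1], are irrelevant. *)
Record plane_bipartite_tree (R : realType) := PlaneBipartiteTree {
  vertex : finType;
  white : pred vertex;
  edge : rel vertex;
  pos : vertex -> R[i];
  arc : vertex -> vertex -> R -> R[i];
  edge_tree : is_tree edge;
  edge_proper : forall x y, edge x y -> white x != white y;
  pos_inj : injective pos;
  arc_simple : forall w u, white w -> edge w u ->
      [/\ {within `[0, 1], continuous (arc w u)},
          {in `[0, 1] &, injective (arc w u)},
          arc w u 0 = pos w & arc w u 1 = pos u];
  arc_avoids_pos : forall w u t x, white w -> edge w u -> 0 < t < 1 ->
      arc w u t != pos x;
  arc_disjoint : forall w u t w' u' t',
      white w -> edge w u -> 0 < t < 1 ->
      white w' -> edge w' u' -> 0 < t' < 1 ->
      arc w u t = arc w' u' t' -> w = w' /\ u = u'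
}.

Section Shabat.
Variables (R : realType) (T : plane_bipartite_tree R).

Definition black : pred (vertex T) := fun x => ~~ white x.

Definition num_edges : nat :=
  #|[set e : vertex T * vertex T | white e.1 && edge e.1 e.2]%SET|.

Definition tree_points : set R[i] :=
  range (@pos R T) `|`
  [set z | exists w u t,
     [/\ @white R T w, edge w u, 0 <= t <= 1 & z = arc w u t]].

Definition white_points : set R[i] := [set pos x | x in [set x | @white R T x]].
Definition black_points : set R[i] := [set pos x | x in [set x | black x]].

Definition segment0 (c : R[i]) : set R[i] :=
  [set (t%:C)%C * c | t in `[0, 1]%classic].

(* b is a Shabat polynomial for T with finite critical values in {0, c}, and h
   is an isomorphism from T onto the bipartite tree b^-1([0, c]); the vertex x
   of T then has coordinate h (pos x).  An isomorphism of plane bipartite trees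
   need only be required to match the underlying point sets and the two colour
   classes: the edges are the closures of the connected components of the point
   set minus the vertices. *)
Definition shabat (b : {poly R[i]}) (c : R[i]) (h : R[i] -> R[i]) : Prop :=
  [/\ size b = num_edges.+1,
      c != 0,
      forall z, root b^`() z -> b.[z] = 0 \/ b.[z] = c,
      plane_homeomorphism h /\ orientation_preserving h
    & [/\ h @` tree_points = [set z | segment0 c b.[z]],
          h @` white_points = [set z | b.[z] = 0]
        & h @` black_points = [set z | b.[z] = c]]].

End Shabat.

(* A finite place of K, given by its normalised valuation. *)
Record finite_place (K : fieldType) := FinitePlace {
  valuation :> K -> \bar int;
  valuation_neqNy : forall x, valuation x != -oo%E;
  valuation_eqy : forall x, valuation x = +oo%E <-> x = 0;
  valuationM : forall x y, valuation (x * y) = (valuation x + valuation y)%E;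
  valuationD : forall x y,
      (Order.min (valuation x) (valuation y) <= valuation (x + y))%E;
  valuation_uniformizer : exists x, valuation x = 1%:E
}.

Definition place_divides (K : fieldType) (rho : finite_place K) (p : nat) :
  bool := (0 < rho p%:R)%E.

Definition integral_at (K : fieldType) (rho : finite_place K) (x : K) : bool :=
  (0 <= rho x)%E.

(* Main.v *)
Require Import Defs.
From HB Require Import structures.
From mathcomp Require Import all_boot all_order all_algebra all_field.
From mathcomp Require Import complex.
From mathcomp Require Import all_classical all_reals all_analysis.
Set Implicit Arguments.
Unset Strict Implicit.
Unset Printing Implicit Defensive.
Import Order.TTheory GRing.Theory Num.Theory.
Local Open Scope ring_scope.

(** Shabat models of a tree can be moved by any affine map, so it suffices to
    find a white vertex [v] and a black vertex [u] for which every quotient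
    [(x - v) / (u - v)], [x] running over the coordinates of the vertices, is
    integral at the place: the model normalised at [v] and [u] is then the
    required one.

    Take [v] white and [u] black as far apart as possible for the absolute
    value of the place ([exists_farthest_pair]).  No vertex is farther from [v]
    than [u] is.  For a black vertex this is the choice of the pair.  A white
    vertex [x] is at most as far from [u] as [v] is, by the same choice, and
    the ultrametric inequality in the triangle [x], [u], [v] concludes.

    The transport of a Shabat model by [z |-> (z - e) / d] is
    [shabat_affine]; its topological part is that such a map is a homeomorphism
    which turns all directions by the same angle, an argument of [d^-1]. *)

Lemma expiD (R : realType) (s t : R) : expi (s + t) = expi s * expi t.
Proof.
apply/eqP; rewrite /expi cosD sinD eq_complex /= eqxx.
by rewrite addrC mulrC eqxx.
Qed.

Lemma polar_form (R : realType) (a : R[i]) : exists t : R, a = `|a| * expi t.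
Proof.
have [->|a0] := eqVneq a 0; first by exists 0; rewrite normr0 mul0r.
suff [t et] : exists t, a / `|a| = expi t.
  by exists t; rewrite -et mulrC divfK ?normr_eq0.
have : `|a / `|a| | = 1 by rewrite normf_div normr_id divff ?normr_eq0.
case: (a / `|a|) => x y; rewrite normc_def /= => /(congr1 (@complex.Re R)) /= xy1.
have {}xy1 : x ^+ 2 + y ^+ 2 = 1.
  rewrite -(sqr_sqrtr (_ : 0 <= x ^+ 2 + y ^+ 2)) ?xy1 ?expr1n //.
  by rewrite addr_ge0 ?sqr_ge0.
have x1 : -1 <= x <= 1.
  rewrite -ler_norml -(@ler_pXn2r _ 2) ?nnegrE // real_normK ?num_real //.
  by rewrite expr1n -xy1 lerDl sqr_ge0.
have x1' : x \in `[-1, 1] by rewrite in_itv.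
have sx : Num.sqrt (1 - x ^+ 2) = `|y| by rewrite -xy1 addrC addKr sqrtr_sqr.
have [y0|y0] := leP 0 y.
  by exists (acos x); rewrite /expi (acosK x1') // sin_acos // sx ger0_norm.
exists (- acos x); rewrite /expi cosN sinN (acosK x1') // sin_acos // sx.
by rewrite ltr0_norm // opprK.
Qed.

Lemma affine_continuous (K : numFieldType) (a s : K) :
  continuous (fun z : K => a * z + s).
Proof.
move=> z; apply: (@continuousD _ _ _ (fun w => a * w) (fun=> s)).
  exact: mulrl_continuous.
exact: cst_continuous.
Qed.

Lemma plane_homeomorphism_affine (R : realType) (h : R[i] -> R[i])
  (d e : R[i]) :
  d != 0 -> plane_homeomorphism h ->
  plane_homeomorphism (fun z => (h z - e) / d).
Proof.
move=> d0 [hc [g [gc hK gK]]]; split.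
  move=> z.
  have -> : (fun z => (h z - e) / d) = (fun w => d^-1 * w + (- e / d)) \o h.
    by apply/funext => w /=; rewrite mulrDl mulrC.
  by apply: continuous_comp; [exact: hc|exact: affine_continuous].
exists (fun w => g (d * w + e)); split.
- move=> z; apply: (@continuous_comp _ _ _ (fun w => d * w + e) g).
    exact: affine_continuous.
  exact: gc.
- by move=> z; rewrite mulrC divfK // subrK hK.
- by move=> w; rewrite gK addrK mulrC mulKf.
Qed.

(** Dividing by [d] multiplies the increments of [h] by [d^-1], hence shifts a
    determination of their argument by a constant, which leaves its variation
    along a circle unchanged. *)
Lemma orientation_preserving_affine (R : realType) (h : R[i] -> R[i])
  (d e : R[i]) :
  orientation_preserving h ->
  orientation_preserving (fun z => (h z - e) / d).
Proof.
move=> hor z r r0; have [theta [thc thE th2]] := hor z r r0.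
have [alpha alphaE] := polar_form d^-1.
exists (fun t => theta t + alpha); split.
- move=> t; apply: (@continuousD _ _ _ theta (fun=> alpha)); first exact: thc.
  exact: cst_continuous.
- move=> t; rewrite -mulrBl opprB addrA subrK normrM expiD mulrACA -thE.
  by rewrite -alphaE.
- by rewrite th2 addrAC.
Qed.

(** The transported polynomial is [b] composed with the inverse
    [w |-> d * w + e] of the affine map; the factor [d ^- N], where [N] is the
    number of edges, makes it monic and rescales the critical value [c]. *)
Lemma shabat_affine (R : realType) (T : plane_bipartite_tree R)
  (b : {poly R[i]}) (c : R[i]) (h : R[i] -> R[i]) (d e : R[i]) :
  d != 0 -> b \is monic -> shabat T b c h ->
  exists (b' : {poly R[i]}) (c' : R[i]),
    b' \is monic /\ shabat T b' c' (fun z => (h z - e) / d).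
Proof.
move=> d0 bm [sb c0 bcrit [hh ho] [hT hw hb]].
set q := d *: 'X + e%:P; set k := d ^- num_edges T.
have k0 : k != 0 by rewrite invr_eq0 expf_neq0.
have qsz : size q = 2%N.
  by rewrite /q -mul_polyC size_MXaddC polyC_eq0 (negPf d0) size_polyC d0.
have qE z : q.[z] = d * z + e by rewrite !hornerE.
have qK w : q.[(w - e) / d] = w by rewrite qE mulrC divfK // subrK.
have bE z : (k *: (b \Po q)).[z] = k * b.[q.[z]] by rewrite hornerZ horner_comp.
(* Each of the three sets to be identified is a condition on the value of the
   polynomial, and the values at corresponding points differ by the factor k. *)
have img (A : set R[i]) (P : R[i] -> Prop) (P' : R[i] -> Prop) :
    (forall w, P (k * w) <-> P' w) -> (h @` A = [set z | P' b.[z]] ->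
    (fun z => (h z - e) / d) @` A = [set z | P (k *: (b \Po q)).[z]])%classic.
  move=> PP' hA; rewrite -(image_comp h (fun w => (w - e) / d)) hA.
  apply/seteqP; split=> [_ [w bw <-]|z] /=.
    by rewrite bE qK; apply/PP'.
  rewrite bE => /PP' bz; exists q.[z] => //.
  by rewrite qE addrK mulrC mulKf.
exists (k *: (b \Po q)), (k * c); split.
  rewrite monicE lead_coefZ lead_coef_comp ?qsz // (monicP bm) mul1r sb /=.
  rewrite [lead_coef q]lead_coefE qsz /q !coefE /= addr0 mulr1.
  by rewrite /k mulVf // expf_neq0.
split.
- by rewrite size_scale // size_comp_poly2.
- exact: mulf_neq0.
- move=> z; rewrite bE rootE derivZ deriv_comp hornerZ hornerM horner_comp.
  have -> : q^`() = d%:P by rewrite /q derivD derivZ derivX derivC addr0 alg_polyC.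
  rewrite hornerC !mulf_eq0 (negPf k0) (negPf d0) orbF /=.
  by move=> /bcrit [] ->; [left; rewrite mulr0|right].
- by split; [exact: plane_homeomorphism_affine|exact: orientation_preserving_affine].
split.
- apply: (img _ (segment0 (k * c)) (segment0 c) _ hT) => w; split.
    move=> [t t01 tE]; exists t => //.
    by apply: (mulfI k0); rewrite -tE mulrCA.
  by move=> [t t01 <-]; exists t => //; rewrite mulrCA.
- apply: (img _ (fun w => w = 0) (fun w => w = 0) _ hw) => w.
  split; last by move->; rewrite mulr0.
  by move/eqP; rewrite mulf_eq0 (negPf k0) => /eqP.
- apply: (img _ (fun w => w = k * c) (fun w => w = c) _ hb) => w.
  by split=> [/(mulfI k0)|->].
Qed.

Lemma valuation_fin_num (K : fieldType) (rho : finite_place K) (x : K) :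
  x != 0 -> rho x \is a fin_num.
Proof.
move=> x0; rewrite fin_numE valuation_neqNy.
by apply: contra_neq x0 => /valuation_eqy.
Qed.

Lemma valuation1 (K : fieldType) (rho : finite_place K) : rho 1 = 0%E.
Proof.
have f1 := valuation_fin_num rho (oner_neq0 K).
have := valuationM rho 1 1; rewrite mul1r.
move: f1; case: (rho 1) => // n _ [] /eqP.
by rewrite -subr_eq subrr => /eqP <-.
Qed.

Lemma valuationN (K : fieldType) (rho : finite_place K) (x : K) :
  rho (- x) = rho x.
Proof.
suff e : rho (-1) = 0%E by rewrite -mulN1r valuationM e add0e.
have f1 : rho (-1) \is a fin_num.
  by rewrite valuation_fin_num // oppr_eq0 oner_eq0.
have := valuationM rho (-1) (-1); rewrite mulrNN mulr1 valuation1.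
move: f1; case: (rho (-1)) => // n _ [] /esym /eqP.
by rewrite -mulr2n mulrn_eq0 /= => /eqP ->.
Qed.

Lemma integral_at_div (K : fieldType) (rho : finite_place K) (x y : K) :
  y != 0 -> (rho y <= rho x)%E -> integral_at rho (x / y).
Proof.
move=> y0; have := valuationM rho (x / y) y; rewrite divfK // => ->.
have := valuation_fin_num rho y0; have := valuation_neqNy rho (x / y).
rewrite /integral_at; case: (rho (x / y)) => [m||] //.
by case: (rho y) => [n||] // _ _; rewrite -EFinD !lee_fin lerDr.
Qed.

(** The pair [v], [u] minimises the valuation of the difference among all pairs
    of a white and a black vertex.  A white [x] is compared with [v] through
    [u]: both [f u - f x] and [f u - f v] are differences of such pairs. *)
Lemma exists_farthest_pair (K : fieldType) (rho : finite_place K) (V : finType)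
  (white : pred V) (f : V -> K) (v1 u1 : V) :
  white v1 -> ~~ white u1 ->
  exists v u, [/\ white v, ~~ white u &
    forall x, (rho (f u - f v)%R <= rho (f x - f v)%R)%E].
Proof.
move=> v1w u1b.
have := @arg_minP _ _ _ (v1, u1) (fun e => white e.1 && ~~ white e.2)
  (fun e => rho (f e.2 - f e.1)).
rewrite /= v1w u1b => /(_ isT) [[v u] /= /andP[vw ub] vumin].
exists v, u; split=> // x.
have [xw|xb] := boolP (white x); last by apply: (vumin (v, x)); rewrite /= vw.
have -> : f x - f v = - (f u - f x) + (f u - f v) by rewrite opprB addrA subrK.
apply: le_trans (valuationD _ _ _); rewrite le_min lexx andbT valuationN.
by apply: (vumin (x, u)); rewrite /= xw.
Qed.

Local Close Scope classical_set_scope.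
Theorem mainTheorem2 (R : realType) (p r : nat) (T : plane_bipartite_tree R)
  (p_prime : prime p) (coprime_pr : coprime p r)
  (T_edges : num_edges T = (p * r)%N)
  (v1 u1 : vertex T) (v1_white : white v1) (u1_black : black u1)
  (b : {poly R[i]}) (c : R[i]) (h : R[i] -> R[i])
  (b_monic : b \is monic) (b_shabat : shabat T b c h)
  (v1_origin : h (pos v1) = 0) (u1_one : h (pos u1) = 1)
  (K : fieldExtType rat) (iota : {rmorphism K -> R[i]})
  (K_coord : forall x : vertex T, exists k : K, iota k = h (pos x))
  (K_value : exists k : K, iota k = b.[1])
  (rho : finite_place K) (rho_p : place_divides rho p) :
  exists (b' : {poly R[i]}) (c' : R[i]) (h' : R[i] -> R[i]),
    [/\ b' \is monic,
        shabat T b' c' h',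
        exists2 v : vertex T, white v & h' (pos v) = 0,
        exists2 u : vertex T, black u & h' (pos u) = 1
      & forall x : vertex T,
          exists2 k : K, iota k = h' (pos x) & integral_at rho k].
Proof.
have [kc kcE] := choice K_coord.
have [v [u [vw ub vu]]] := exists_farthest_pair rho kc v1_white u1_black.
have [_ _ _ [[_ [g [_ hK _]]] _] _] := b_shabat.
have duv : kc u - kc v != 0.
  rewrite subr_eq0; apply: contraNneq ub => uv.
  suff -> : u = v by [].
  by apply: (@pos_inj _ T); apply: (can_inj hK); rewrite -!kcE uv.
have hduv : h (pos u) - h (pos v) != 0.
  by rewrite -!kcE -rmorphB fmorph_eq0.
have [b' [c' [b'm b'sh]]] := shabat_affine (h (pos v)) hduv b_monic b_shabat.
exists b', c', (fun z => (h z - h (pos v)) / (h (pos u) - h (pos v))); split=> //.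
- by exists v => //; rewrite subrr mul0r.
- by exists u => //; rewrite divff.
move=> x; exists ((kc x - kc v) / (kc u - kc v)).
  by rewrite fmorph_div !rmorphB /= !kcE.
exact: integral_at_div (vu x).
Qed.
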